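(* Suppose that: (a) $f:\mathbb{R}^n\times\mathbb{R}^m\to\mathbb{R}$ is continuous in $(\mathbf{x},\mathbf{y})$; (b) $\mathcal{X}\subseteq\mathbb{R}^n$ and $\mathcal{Y}\subseteq\mathbb{R}^m$ are convex and compact, with $\|\mathbf{x}\|\le D$ for all $\mathbf{x}\in\mathcal{X}$ and $\|\mathbf{y}\|\le D$ for all $\mathbf{y}\in\mathcal{Y}$ for some constant $D>0$; (c) for every $\mathbf{x}\in\mathcal{X}$ there exists $\mathbf{y}\in\mathcal{Y}$ with $A\mathbf{x}+B\mathbf{y}-\mathbf{c}\le\mathbf{0}$; (d) for every $\mathbf{x}\in\mathcal{X}$, $f(\mathbf{x},\cdot)$ is strongly concave in $\mathbf{y}$ with modulus $\mu_y$; (e) for every $\mathbf{x}\in\mathcal{X}$ there exists $\mathbf{y}\in\mathrm{relint}(\mathcal{Y})$ with $A\mathbf{x}+B\mathbf{y}-\mathbf{c}\le\mathbf{0}$. Then strong duality holds: $$v(\text{mM-I})=v(\text{D1})=v(\text{D2})=v(\text{D3}).$$ Moreover: \begin{enumerate} \item A pair $(\mathbf{x}^*,\mathbf{y}^* )$ is a solution of (mM-I) if and only if there exists $\boldsymbol{\lambda}^*\ge\mathbf{0}$ such that $(\mathbf{x}^*,\mathbf{y}^*,\boldsymbol{\lambda}^* )$ is a solution of (D2). \item A pair $(\mathbf{x}^*,\mathbf{y}^* )$ is a solution of (mM-I) if and only if there exists $\boldsymbol{\lambda}^*\ge\mathbf{0}$ such that $(\mathbf{x}^*,\mathbf{y}^*,\boldsymbol{\lambda}^*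 )$ is a solution of (D3). \end{enumerate}
   Context: Let $A\in\mathbb{R}^{k\times n}$, $B\in\mathbb{R}^{k\times m}$, $\mathbf{c}\in\mathbb{R}^k$; vector inequalities are componentwise. The primal problem is (mM-I): $\min_{\mathbf{x}\in\mathcal{X}}\big(\max_{\mathbf{y}\in\mathcal{Y},\,A\mathbf{x}+B\mathbf{y}\le\mathbf{c}} f(\mathbf{x},\mathbf{y})\big)$. A solution of (mM-I) is a pair $(\mathbf{x}^*,\mathbf{y}^* )$ with $\mathbf{x}^*\in\arg\min_{\mathbf{x}\in\mathcal{X}}\phi(\mathbf{x})$, where $\phi(\mathbf{x})=\max_{\mathbf{y}\in\mathcal{Y},A\mathbf{x}+B\mathbf{y}\le\mathbf{c}} f(\mathbf{x},\mathbf{y})$, and $\mathbf{y}^*\in\arg\max_{\mathbf{y}\in\mathcal{Y},A\mathbf{x}^*+B\mathbf{y}\le\mathbf{c}} f(\mathbf{x}^*,\mathbf{y})$. The Lagrangian is $L(\mathbf{x},\mathbf{y},\boldsymbol{\lambda})=f(\mathbf{x},\mathbf{y})-\boldsymbol{\lambda}^T(A\mathbf{x}+B\mathbf{y}-\mathbf{c})$, $\boldsymbol{\lambda}\in\mathbb{R}^k$, $\boldsymbol{\lambda}\ge\mathbf{0}$. The dual problems are (D1): $\min_{\mathbf{x}\in\mathcal{X}}\big(\min_{\boldsymbol{\lambda}\ge\mathbf{0}}\max_{\mathbf{y}\in\mathcal{Y}} L(\mathbf{x},\mathbf{y},\boldsymbol{\lambda})\big)$, (D2): $\min_{\boldsymbol{\lambda}\ge\mathbf{0}}\big(\min_{\mathbf{x}\in\mathcal{X}}\max_{\mathbf{y}\in\mathcal{Y}}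 L(\mathbf{x},\mathbf{y},\boldsymbol{\lambda})\big)$, (D3): $\min_{\boldsymbol{\lambda}\ge\mathbf{0},\,\mathbf{x}\in\mathcal{X}}\big(\max_{\mathbf{y}\in\mathcal{Y}} L(\mathbf{x},\mathbf{y},\boldsymbol{\lambda})\big)$. $v(P)$ denotes the optimal objective value of $P$ (min and max are read as inf and sup if not attained). A triple $(\mathbf{x}^*,\mathbf{y}^*,\boldsymbol{\lambda}^* )$ is a solution of (D2) if (1) $(\mathbf{x}^*,\mathbf{y}^* )$ is a minimax point of the inner problem at $\boldsymbol{\lambda}=\boldsymbol{\lambda}^*$, i.e. $\mathbf{x}^*\in\arg\min_{\mathbf{x}\in\mathcal{X}}\max_{\mathbf{y}\in\mathcal{Y}}L(\mathbf{x},\mathbf{y},\boldsymbol{\lambda}^* )$ and $\mathbf{y}^*\in\arg\max_{\mathbf{y}\in\mathcal{Y}}L(\mathbf{x}^*,\mathbf{y},\boldsymbol{\lambda}^* )$, and (2) $\boldsymbol{\lambda}^*\in\arg\min_{\boldsymbol{\lambda}\ge\mathbf{0}}G(\boldsymbol{\lambda})$, where $G(\boldsymbol{\lambda})=\min_{\mathbf{x}\in\mathcal{X}}\max_{\mathbf{y}\in\mathcal{Y}}L(\mathbf{x},\mathbf{y},\boldsymbol{\lambda})$. It is a solution of (D3) if $(\mathbf{x}^*,\boldsymbol{\lambda}^* )\in\arg\min_{\boldsymbol{\lambda}\ge\mathbf{0},\mathbf{x}\in\mathcal{X}}\max_{\mathbf{y}\in\mathcal{Y}}L(\mathbf{x},\mathbf{y},\boldsymbol{\lambda})$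 and $\mathbf{y}^*\in\arg\max_{\mathbf{y}\in\mathcal{Y}}L(\mathbf{x}^*,\mathbf{y},\boldsymbol{\lambda}^* )$. Strong concavity with modulus $\mu_y>0$ of $f(\mathbf{x},\cdot)$ on $\mathcal{Y}$ means $f(\mathbf{x},\cdot)+\frac{\mu_y}{2}\|\cdot\|^2$ is concave on $\mathcal{Y}$. $\mathrm{relint}$ denotes relative interior. *)

(* Defs.v *)
From HB Require Import structures.
From mathcomp Require Import all_boot all_order all_algebra.
From mathcomp Require Import boolp classical_sets reals ereal topology normedtype.
From mathcomp Require Import convex.

Set Implicit Arguments.
Unset Strict Implicit.
Unset Printing Implicit Defensive.

Import Order.TTheory GRing.Theory Num.Theory.
Import numFieldNormedType.Exports.

Local Open Scope classical_set_scope.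
Local Open Scope ring_scope.

Definition argmin {T : Type} {d : Order.disp_t} {V : porderType d}
    (D : set T) (g : T -> V) : set T :=
  [set t | D t /\ forall s, D s -> (g t <= g s)%O].

Definition argmax {T : Type} {d : Order.disp_t} {V : porderType d}
    (D : set T) (g : T -> V) : set T :=
  [set t | D t /\ forall s, D s -> (g s <= g t)%O].

(* The library's norm on matrices is the sup norm, hence this definition. *)
Definition enorm {R : realType} {n : nat} (x : 'cV[R]_n) : R :=
  Num.sqrt (\sum_(i < n) x i 0 ^+ 2).

Definition vle {R : realType} {k : nat} (u v : 'cV[R]_k) : Prop :=
  forall i : 'I_k, u i 0 <= v i 0.

Definition concave_function {R : realType} {E : lmodType R}
    (D : set E) (g : E -> R) : Prop :=
  @convex_function R E D (fun y => - g y).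

Definition strongly_concave {R : realType} {m : nat}
    (mu : R) (D : set 'cV[R]_m) (g : 'cV[R]_m -> R) : Prop :=
  concave_function D (fun y => g y + mu / 2 * enorm y ^+ 2).

Definition affine_hull {R : realType} {m : nat}
    (S : set 'cV[R]_m) : set 'cV[R]_m :=
  [set z | exists (p : nat) (w : 'I_p -> R) (v : 'I_p -> 'cV[R]_m),
     [/\ forall i, S (v i), \sum_(i < p) w i = 1
       & z = \sum_(i < p) w i *: v i]].

Definition relint {R : realType} {m : nat}
    (S : set 'cV[R]_m) : set 'cV[R]_m :=
  [set y | S y /\ \forall z \near y, affine_hull S z -> S z].

(* In all the problems below, min and max are infima and suprema in \bar R. *)
Section problems.
Context {R : realType} {n m k : nat}.
Context (f : 'cV[R]_n -> 'cV[R]_m -> R).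
Context (A : 'M[R]_(k, n)) (B : 'M[R]_(k, m)) (c : 'cV[R]_k).
Context (X : set 'cV[R]_n) (Y : set 'cV[R]_m).

Definition feasible (x : 'cV[R]_n) : set 'cV[R]_m :=
  [set y | Y y /\ vle (A *m x + B *m y) c].

Definition phi (x : 'cV[R]_n) : \bar R :=
  ereal_sup [set (f x y)%:E | y in feasible x].

Definition v_mMI : \bar R := ereal_inf [set phi x | x in X].

Definition solution_mMI (x : 'cV[R]_n) (y : 'cV[R]_m) : Prop :=
  argmin X phi x /\ argmax (feasible x) (f x) y.

Definition Lagrangian (x : 'cV[R]_n) (y : 'cV[R]_m) (l : 'cV[R]_k) : R :=
  f x y - (l^T *m (A *m x + B *m y - c)) 0 0.

Definition multipliers : set 'cV[R]_k := [set l | vle 0 l].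

Definition maxL (x : 'cV[R]_n) (l : 'cV[R]_k) : \bar R :=
  ereal_sup [set (Lagrangian x y l)%:E | y in Y].

Definition G (l : 'cV[R]_k) : \bar R := ereal_inf [set maxL x l | x in X].

Definition v_D1 : \bar R :=
  ereal_inf [set ereal_inf [set maxL x l | l in multipliers] | x in X].

Definition v_D2 : \bar R := ereal_inf [set G l | l in multipliers].

Definition v_D3 : \bar R :=
  ereal_inf [set maxL p.1 p.2 | p in X `*` multipliers].

Definition solution_D2 (x : 'cV[R]_n) (y : 'cV[R]_m) (l : 'cV[R]_k) : Prop :=
  [/\ argmin X (fun x' => maxL x' l) x,
      argmax Y (fun y' => Lagrangian x y' l) y
    & argmin multipliers G l].

Definition solution_D3 (x : 'cV[R]_n) (y : 'cV[R]_m) (l : 'cV[R]_k) : Prop :=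
  argmin (X `*` multipliers) (fun p => maxL p.1 p.2) (x, l) /\
  argmax Y (fun y' => Lagrangian x y' l) y.

End problems.

(* Main.v *)
Require Import Defs.
From HB Require Import structures.
From mathcomp Require Import all_boot all_order all_algebra.
From mathcomp Require Import boolp classical_sets reals ereal topology normedtype.
From mathcomp Require Import convex interval_inference.
From mathcomp Require Import derive ring lra.

(** For each fixed x the inner maximization is a concave program with affine
    constraints, and the theorem says that it may be replaced by its Lagrangian
    dual. Once every x in X has a multiplier l >= 0 with maxL x l = phi x
    ([strong_duality]), the rest is formal: together with [weak_duality] it
    makes phi x the minimum of maxL x over the multipliers, the three dual
    problems differ only in the order in which infima are taken
    ([ereal_inf_pair]), and a solution of the primal problem solves the joint
    minimization with the multiplier of x. Conversely, if (x, y, l) solves the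
    joint minimization, then maxL x l = phi x, so a primal maximizer at x,
    which exists by compactness, also maximizes L x . l; strong concavity makes
    that maximizer unique, hence it is y ([solution_mMI_D3]).

    The substance is the existence of multipliers when the only point known to
    satisfy the constraints in the relative interior of Y may make all of them
    active, as is the case for equality constraints written as two
    inequalities. [affine_multipliers] proves it by induction on the number of
    constraints, without separation theorems in higher dimension. Let h be the
    first constraint and look at the points of Y that satisfy the others.

    - If h < 0 at one of them, the one-constraint multiplier rule on the set of
      these points moves h into the objective, and the induction hypothesis
      treats the other constraints.
    - Otherwise h >= 0 on that set. The induction hypothesis applied to the
      objective - h yields mu >= 0 with h + sum_i mu_i h_i >= 0 on Y. This
      affine function vanishes at a relative interior point, hence on all of
      Y. The induction hypothesis on Y cut by h = 0 gives multipliers for the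
      other constraints, and a multiplier nu of either sign for h = 0 then
      exists. If nu < 0, the identity h = - sum_i mu_i h_i turns nu h into
      a combination of the other constraints with nonnegative coefficients.

    The induction uses of the relative interior only that segments ending at
    the point can be prolonged within the set ([prolongable]), a property which
    passes to the slice h = 0. *)

Set Implicit Arguments.
Unset Strict Implicit.
Unset Printing Implicit Defensive.

Import Order.TTheory GRing.Theory Num.Theory.
Import numFieldNormedType.Exports.

Local Open Scope classical_set_scope.
Local Open Scope ring_scope.

(** * Convex combinations with a real weight *)

Lemma convex_setP (R : numDomainType) (E : lmodType R) (Y : set E) :
  convex_set Y <->
  forall (t : R) (x y : E), 0 <= t <= 1 -> Y x -> Y y ->
    Y (t *: x + (1 - t) *: y).
Proof.
split=> [cY t x y /andP[t0 t1] Yx Yy|cY x y t].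
  have /(_ (mem_set Yx) (mem_set Yy)) := cY x y (Itv01 t0 t1).
  by rewrite inE.
rewrite !inE => Yx Yy; apply: cY => //.
by apply/andP; split; [exact: ge0|exact: le1].
Qed.

Lemma concave_functionP (R : realType) (E : lmodType R) (Y : set E)
    (g : E -> R) :
  concave_function Y g <->
  forall (t : R) (x y : E), 0 <= t <= 1 -> Y x -> Y y ->
    t * g x + (1 - t) * g y <= g (t *: x + (1 - t) *: y).
Proof.
split=> [cg t x y /andP[t0 t1] Yx Yy|cg t x y].
  have : - g (t *: x + (1 - t) *: y) <= t * - g x + (1 - t) * - g y
    := cg (Itv01 t0 t1) x y (mem_set Yx) (mem_set Yy).
  by rewrite !mulrN -opprD lerN2.
rewrite !inE => Yx Yy.
change (- g (t%:num *: x + (1 - t%:num) *: y) <=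
  t%:num * - g x + (1 - t%:num) * - g y).
rewrite !mulrN -opprD lerN2; apply: cg => //.
by apply/andP; split; [exact: ge0|exact: le1].
Qed.

(** * Multipliers for affine constraints *)

Definition affine_functional (R : realType) (E : lmodType R) (h : E -> R) :=
  forall t x y, h (t *: x + (1 - t) *: y) = t * h x + (1 - t) * h y.

(** This is the algebraic form of the relative interior of a convex set: each
    segment of Y that ends at the point extends beyond it inside Y. *)
Definition prolongable (R : realType) (E : lmodType R) (Y : set E) : set E :=
  [set y0 | Y y0 /\
    forall y, Y y -> exists2 t, 1 < t & Y (t *: y0 + (1 - t) *: y)].

Section lagrange.
Context {R : realType} {E : lmodType R}.
Implicit Types (Y : set E) (g h : E -> R).

Lemma affine_functional_sum k (l : 'I_k -> R) (h : 'I_k -> E -> R) :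
  (forall i, affine_functional (h i)) ->
  affine_functional (fun y => \sum_(i < k) l i * h i y).
Proof.
move=> ah t x y; rewrite !mulr_sumr -big_split /=; apply: eq_bigr => i _.
by rewrite ah; ring.
Qed.

Lemma affine_functionalZ (x : R) h :
  affine_functional h -> affine_functional (fun y => x * h y).
Proof. by move=> ah t u v; rewrite ah; ring. Qed.

Lemma affine_functionalD h1 h2 : affine_functional h1 -> affine_functional h2 ->
  affine_functional (fun y => h1 y + h2 y).
Proof. by move=> ah1 ah2 t u v; rewrite ah1 ah2; ring. Qed.

Lemma affine_functional_concaveN Y h :
  affine_functional h -> concave_function Y (fun y => - h y).
Proof.
by move=> ah; apply/concave_functionP => t x y _ _ _; rewrite ah; lra.
Qed.

Lemma concave_functionB Y g h : concave_function Y g -> affine_functional h ->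
  concave_function Y (fun y => g y - h y).
Proof.
move=> /concave_functionP cg ah; apply/concave_functionP => t x y t01 Yx Yy.
have := cg t x y t01 Yx Yy; rewrite ah; lra.
Qed.

Lemma concave_functionS Y Z g : Y `<=` Z -> concave_function Z g ->
  concave_function Y g.
Proof.
move=> YZ /concave_functionP cg; apply/concave_functionP => t x y t01 Yx Yy.
by apply: cg => //; exact: YZ.
Qed.

(** A point on each side of the hyperplane h = 0 spans a segment that crosses
    it, where g <= 0. By concavity this says that every slope g / h on the side
    h > 0 is at most every slope g / h on the side h < 0, so any number between
    the two families is a multiplier. *)
Lemma equality_multiplier Y g h (a b : E) :
  convex_set Y -> concave_function Y g -> affine_functional h ->
  Y a -> h a < 0 -> Y b -> 0 < h b ->
  (forall y, Y y -> h y = 0 -> g y <= 0) ->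
  exists nu, forall y, Y y -> g y <= nu * h y.
Proof.
move=> /convex_setP cY /concave_functionP cg ah Ya ha Yb hb g0.
pose S := [set g y / h y | y in [set y | Y y /\ 0 < h y]].
have le_slope y z : Y y -> 0 < h y -> Y z -> h z < 0 -> g y / h y <= g z / h z.
  move=> Yy hy Yz hz; pose t := - h z / (h y - h z).
  have d0 : 0 < h y - h z by lra.
  have t01 : 0 <= t <= 1.
    by rewrite /t; apply/andP; split;
      [apply: divr_ge0; lra | rewrite ler_pdivrMr //; lra].
  have hw : h (t *: y + (1 - t) *: z) = 0 by rewrite ah /t; field; lra.
  have /le_trans := cg t y z t01 Yy Yz.
  move=> /(_ _ (g0 _ (cY _ _ _ t01 Yy Yz) hw)).
  have -> : t * g y + (1 - t) * g z = (- h z * g y + h y * g z) / (h y - h z).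
    by rewrite /t; field; lra.
  rewrite pmulr_lle0 ?invr_gt0 // => le0.
  rewrite ler_pdivrMr // mulrAC ler_ndivlMr //; lra.
have ubS z : Y z -> h z < 0 -> ubound S (g z / h z).
  by move=> Yz hz _ [y [Yy hy] <-]; exact: le_slope.
have S0 : S !=set0 by exists (g b / h b); exists b.
exists (sup S) => y Yy; have [hy|hy|hy] := ltgtP (h y) 0.
- by rewrite -ler_ndivlMr //; apply: ge_sup => //; exact: ubS.
- rewrite -ler_pdivrMr //; apply: ub_le_sup; last by exists y.
  by exists (g a / h a); exact: ubS.
- by rewrite hy mulr0; exact: g0.
Qed.

(** The multiplier of the equality h = 0 can be used unless it is negative; in
    that case g <= 0 on the side h > 0 too, and 0 is a multiplier. *)
Lemma inequality_multiplier Y g h (a : E) :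
  convex_set Y -> concave_function Y g -> affine_functional h ->
  Y a -> h a < 0 ->
  (forall y, Y y -> h y <= 0 -> g y <= 0) ->
  exists2 nu, 0 <= nu & forall y, Y y -> g y <= nu * h y.
Proof.
move=> cY cg ah Ya ha g0.
have [[b [Yb hb]]|noh] := pselect (exists b, Y b /\ 0 < h b); last first.
  exists 0 => // y Yy; rewrite mul0r; apply: g0 => //.
  by rewrite leNgt; apply/negP => hy; apply: noh; exists y.
have [|nu gnu] := equality_multiplier cY cg ah Ya ha Yb hb.
  by move=> y Yy hy; apply: g0 => //; rewrite hy.
have [nu0|nu0] := leP 0 nu; first by exists nu.
exists 0 => // y Yy; rewrite mul0r.
have [hy|hy] := leP (h y) 0; first exact: g0.
by apply: le_trans (gnu _ Yy) _; nra.
Qed.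

(** If h y > 0, prolonging the segment from y to the zero y0 of h would reach a
    point of Y where h < 0. *)
Lemma prolongable_affine_eq0 Y h y0 : prolongable Y y0 -> affine_functional h ->
  (forall y, Y y -> 0 <= h y) -> h y0 = 0 -> forall y, Y y -> h y = 0.
Proof.
move=> [_ pY] ah h0 hy0 y Yy; have [t t1 Yt] := pY y Yy.
have := h0 _ Yt; have := h0 _ Yy; rewrite ah hy0; nra.
Qed.

(** An upper bound of the objective on the feasible set, here normalized to 0,
    is an upper bound of the Lagrangian on Y for some nonnegative
    multipliers. Since active constraints are allowed at y0, the constraints
    cannot simply be treated one after the other: y0 may cease to be
    prolongable in the part of Y cut out by an inequality. Hence the set is cut
    by an equality only, and the case split is on whether h can be strict. *)
Lemma affine_multipliers k (h : 'I_k -> E -> R) Y g y0 :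
  convex_set Y -> concave_function Y g -> (forall i, affine_functional (h i)) ->
  prolongable Y y0 -> (forall i, h i y0 <= 0) ->
  (forall y, Y y -> (forall i, h i y <= 0) -> g y <= 0) ->
  exists2 l : 'I_k -> R, (forall i, 0 <= l i) &
    forall y, Y y -> g y <= \sum_(i < k) l i * h i y.
Proof.
elim: k => [|k IH] in h Y g y0 *.
  move=> _ _ _ _ _ g0; exists (fun=> 0) => // y Yy.
  by rewrite big_ord0; apply: g0 => // -[].
move=> cY cg ah py0 hy0 g0.
have [Yy0 pY] := py0.
pose h' i := h (lift ord0 i).
have ah' i : affine_functional (h' i) by exact: ah.
have hP y : h ord0 y <= 0 -> (forall i, h' i y <= 0) -> forall i, h i y <= 0.
  move=> ? h'y i; case: (unliftP ord0 i) => [j ->|->] //; exact: h'y.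
pose cons (x : R) (l : 'I_k -> R) i := oapp l x (unlift ord0 i).
have cons_ge0 x l : 0 <= x -> (forall i, 0 <= l i) -> forall i, 0 <= cons x l i.
  by move=> ? ? i; rewrite /cons; case: unlift.
have sum_cons x l y : \sum_(i < k.+1) cons x l i * h i y =
    x * h ord0 y + \sum_(i < k) l i * h' i y.
  rewrite big_ord_recl /cons unlift_none; congr (_ + _).
  by apply: eq_bigr => i _; rewrite liftK.
pose Y' := Y `&` [set y | forall i, h' i y <= 0].
have [[a [[Ya ha'] ha]]|noa] := pselect (exists a, Y' a /\ h ord0 a < 0).
  have cY' : convex_set Y'.
    apply/convex_setP => t x y t01 [Yx hx] [Yy hy]; split.
      exact: (convex_setP Y).1.
    move=> i /=; rewrite ah'; have := hx i; have := hy i; nra.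
  have [|x x0 gx] := inequality_multiplier cY'
      (concave_functionS (@subIsetl _ _ _) cg) (ah ord0) (conj Ya ha') ha.
    by move=> y [Yy hy] h0y; apply: g0 => //; exact: hP.
  have [|//|//|||l l0 gl] := IH h' Y (fun y => g y - x * h ord0 y) y0 cY.
  - by apply: concave_functionB => //; exact: affine_functionalZ.
  - by move=> i; exact: hy0.
  - by move=> y Yy hy; rewrite subr_le0; exact: gx.
  exists (cons x l); first exact: cons_ge0.
  by move=> y Yy; rewrite sum_cons -lerBlDl; exact: gl.
have h_ge0 y : Y y -> (forall i, h' i y <= 0) -> 0 <= h ord0 y.
  by move=> Yy hy; rewrite leNgt; apply/negP => hlt; apply: noa; exists y.
have hy00 : h ord0 y0 = 0.
  by apply/eqP; rewrite eq_le hy0 h_ge0 // => i; exact: hy0.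
have [|//|//|||mu mu0 hmu] := IH h' Y (fun y => - h ord0 y) y0 cY.
- exact: affine_functional_concaveN.
- by move=> i; exact: hy0.
- by move=> y Yy hy; rewrite oppr_le0; exact: h_ge0.
pose hmu0 y := h ord0 y + \sum_(i < k) mu i * h' i y.
have hE y : Y y -> hmu0 y = 0.
  apply: (prolongable_affine_eq0 (h := hmu0) py0).
  - by apply: affine_functionalD => //; exact: affine_functional_sum.
  - by move=> z Yz; have := hmu z Yz; rewrite /hmu0; lra.
  - apply/eqP; rewrite eq_le; apply/andP; split.
      rewrite /hmu0 hy00 add0r; apply: sumr_le0 => i _.
      by rewrite mulr_ge0_le0 //; exact: hy0.
    by have := hmu y0 Yy0; rewrite /hmu0; lra.
pose Z := Y `&` [set y | h ord0 y = 0].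
have cZ : convex_set Z.
  apply/convex_setP => t x y t01 [Yx hx] [Yy hy]; split.
    exact: (convex_setP Y).1.
  by rewrite /= ah hx hy !mulr0 addr0.
have pZ : prolongable Z y0.
  split=> // y [Yy hy]; have [t t1 Yt] := pY y Yy.
  by exists t => //; split=> //=; rewrite ah hy hy00 !mulr0 addr0.
have [//|//|||l l0 gl] :=
    IH h' Z g y0 cZ (concave_functionS (@subIsetl _ _ _) cg).
- by move=> i; exact: hy0.
- by move=> y [Yy h0y] hy; apply: g0 => //; apply: hP => //; rewrite h0y.
have [nu gnu] : exists nu, forall y, Y y ->
    g y - \sum_(i < k) l i * h' i y <= nu * h ord0 y.
  have [[a [Ya ha]]|nneg] := pselect (exists a, Y a /\ h ord0 a < 0).
    have [t t1 Yt] := pY a Ya.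
    apply: (@equality_multiplier Y _ _ a (t *: y0 + (1 - t) *: a)) => //.
    - by apply: concave_functionB => //; exact: affine_functional_sum.
    - by rewrite ah hy00; nra.
    - by move=> y Yy h0y; rewrite subr_le0; exact: gl.
  exists 0 => y Yy; rewrite mul0r subr_le0; apply: gl; split=> //=.
  apply: (prolongable_affine_eq0 py0) => // z Yz.
  by rewrite leNgt; apply/negP => hz; apply: nneg; exists z.
(* A negative nu is traded, through hE, for nonnegative multiples of h'. *)
have [nu0|nu0] := leP 0 nu.
  exists (cons nu l); first exact: cons_ge0.
  by move=> y Yy; rewrite sum_cons; have := gnu y Yy; lra.
exists (cons 0 (fun i => l i - nu * mu i)).
  by apply: cons_ge0 => // i; have := l0 i; have := mu0 i; nra.
move=> y Yy; rewrite sum_cons mul0r add0r.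
under eq_bigr do rewrite mulrBl -mulrA.
rewrite sumrB -mulr_sumr; have := gnu y Yy; have := hE y Yy.
by rewrite /hmu0; nra.
Qed.
End lagrange.


(** * Relative interior and strong concavity *)

(** The points t y0 + (1 - t) y lie in the affine hull and tend to y0 as t
    tends to 1, so they belong to Y for some t > 1. *)
Lemma relint_prolongable (R : realType) (m : nat) (Y : set 'cV[R]_m) y0 :
  relint Y y0 -> prolongable Y y0.
Proof.
move=> [Yy0 nY]; split=> // y Yy.
pose z (t : R) : 'cV[R]_m := t *: y0 + (1 - t) *: y.
have cz : z t @[t --> (1 : R)] --> y0.
  rewrite (_ : y0 = z 1); last by rewrite /z subrr scale0r addr0 scale1r.
  apply: cvgD; apply: cvgZr_tmp; first exact: cvg_id.
  by apply: cvgB; [exact: cvg_cst|exact: cvg_id].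
have /nbhs_ballP[e /= e0 He] := cz _ nY.
exists (1 + e / 2); first by rewrite ltrDl divr_gt0.
apply: He.
  rewrite /ball /= opprD addNKr normrN gtr0_norm ?divr_gt0 //.
  by rewrite ltr_pdivrMr //; lra.
exists 2, (fun i => if i == 0 then 1 + e / 2 else 1 - (1 + e / 2)),
  (fun i => if i == 0 then y0 else y); split.
- by move=> i; case: ifP.
- by rewrite !big_ord_recl big_ord0 /=; lra.
- by rewrite !big_ord_recl big_ord0 /= addr0.
Qed.

Lemma enorm_sqr (R : realType) (m : nat) (u : 'cV[R]_m) :
  enorm u ^+ 2 = \sum_(i < m) u i 0 ^+ 2.
Proof. by rewrite sqr_sqrtr // sumr_ge0 // => i _; exact: sqr_ge0. Qed.

(** The parallelogram identity for an arbitrary weight. It turns strong concavity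
    into the concavity inequality with the additional term
    mu / 2 t (1 - t) |u - v|^2 on the smaller side. *)
Lemma enorm_conv (R : realType) (m : nat) (t : R) (u v : 'cV[R]_m) :
  enorm (t *: u + (1 - t) *: v) ^+ 2 =
  t * enorm u ^+ 2 + (1 - t) * enorm v ^+ 2
  - t * (1 - t) * enorm (u - v) ^+ 2.
Proof.
rewrite !enorm_sqr !mulr_sumr -big_split -sumrB /=; apply: eq_bigr => i _.
by rewrite !mxE; ring.
Qed.

Lemma enorm_eq0 (R : realType) (m : nat) (u : 'cV[R]_m) :
  enorm u ^+ 2 <= 0 -> u = 0.
Proof.
rewrite enorm_sqr => le0; apply/matrixP => i j; rewrite ord1 mxE.
have sq_ge0 (a : 'I_m) : true -> 0 <= u a 0 ^+ 2 by move=> _; exact: sqr_ge0.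
have sum0 : \sum_(a < m) u a 0 ^+ 2 = 0.
  by apply/eqP; rewrite eq_le le0 sumr_ge0.
by apply/eqP; rewrite -(sqrf_eq0 (u i 0)) (psumr_eq0P sq_ge0 sum0).
Qed.

Lemma strongly_concave_concave (R : realType) (m : nat) (Y : set 'cV[R]_m)
    (mu : R) (g : 'cV[R]_m -> R) :
  0 <= mu -> strongly_concave mu Y g -> concave_function Y g.
Proof.
move=> mu0 /concave_functionP cg; apply/concave_functionP => t u v t01 Yu Yv.
have := cg t u v t01 Yu Yv; rewrite enorm_conv.
have : 0 <= mu / 2 * (t * (1 - t) * enorm (u - v) ^+ 2).
  have /andP[t0 t1] := t01; rewrite mulr_ge0 ?divr_ge0 //.
  by apply: mulr_ge0; [apply: mulr_ge0; lra | exact: sqr_ge0].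
lra.
Qed.

(** Two maximizers have the same value, and at their midpoint strong concavity
    exceeds it by mu / 8 times the squared distance between them. *)
Lemma strongly_concave_argmax_unique (R : realType) (m : nat)
    (Y : set 'cV[R]_m) (mu : R) (g h : 'cV[R]_m -> R) (u v : 'cV[R]_m) :
  0 < mu -> convex_set Y -> strongly_concave mu Y g -> affine_functional h ->
  argmax Y (fun y => g y - h y) u -> argmax Y (fun y => g y - h y) v -> u = v.
Proof.
move=> mu0 /convex_setP cY /concave_functionP cg ah [Yu umax] [Yv vmax].
have t01 : 0 <= (2^-1 : R) <= 1 by lra.
have := cg 2^-1 u v t01 Yu Yv; rewrite enorm_conv.
have := umax _ (cY _ _ _ t01 Yu Yv); have := umax _ Yv; have := vmax _ Yu.
rewrite ah => *; apply/eqP; rewrite -subr_eq0; apply/eqP/enorm_eq0.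
have : mu * enorm (u - v) ^+ 2 <= 0 by lra.
by rewrite pmulr_rle0.
Qed.

(** * Lagrangian duality for the inner problem *)

Section duality.
Context {R : realType} {n m k : nat}.
Context (f : 'cV[R]_n -> 'cV[R]_m -> R).
Context (A : 'M[R]_(k, n)) (B : 'M[R]_(k, m)) (c : 'cV[R]_k).
Context (X : set 'cV[R]_n) (Y : set 'cV[R]_m).

Local Notation residual x y := (A *m x + B *m y - c).
Local Notation L := (Lagrangian f A B c).
Local Notation maxL := (maxL f A B c Y).
Local Notation phi := (phi f A B c Y).
Local Notation feasible := (feasible A B c Y).
Local Notation multipliers := (@multipliers R k).
Local Notation G := (G f A B c X Y).
Local Notation mMI := (solution_mMI f A B c X Y).
Local Notation D2 := (solution_D2 f A B c X Y).
Local Notation D3 := (solution_D3 f A B c X Y).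

Lemma vle_subr (u v : 'cV[R]_k) : vle (u - v) 0 <-> vle u v.
Proof. by split=> + i => /(_ i); rewrite !mxE subr_le0. Qed.

Lemma vle0l (l : 'cV[R]_k) : vle 0 l <-> forall i, 0 <= l i 0.
Proof. by split=> + i => /(_ i); rewrite mxE. Qed.

Lemma vle0r (u : 'cV[R]_k) : vle u 0 <-> forall i, u i 0 <= 0.
Proof. by split=> + i => /(_ i); rewrite (mxE _ (fun=> fun=> 0)). Qed.

Lemma LagrangianE x y l :
  L x y l = f x y - \sum_(i < k) l i 0 * residual x y i 0.
Proof. by rewrite /Lagrangian mxE; under eq_bigr do rewrite mxE. Qed.

Lemma residual_affine x i : affine_functional (fun y => residual x y i 0).
Proof.
move=> t u v; rewrite mulmxDr -!scalemxAr.
by move: (A *m x) (B *m u) (B *m v) => a p q; rewrite !mxE; ring.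
Qed.

Lemma Lagrangian_ge x y l : vle 0 l -> feasible x y -> f x y <= L x y l.
Proof.
move=> /vle0l l0 [_ /vle_subr/vle0r hy]; rewrite LagrangianE lerDl oppr_ge0.
by apply: sumr_le0 => i _; rewrite mulr_ge0_le0.
Qed.

Lemma weak_duality x l : vle 0 l -> (phi x <= maxL x l)%E.
Proof.
move=> l0; apply: ge_ereal_sup => _ [y xy <-].
apply: (@le_trans _ _ (L x y l)%:E); first by rewrite lee_fin Lagrangian_ge.
by apply: ereal_sup_ubound; exists y => //; case: xy.
Qed.

Lemma phi_argmax x y : argmax (feasible x) (f x) y -> phi x = (f x y)%:E.
Proof.
move=> [xy ymax]; apply/eqP; rewrite eq_le; apply/andP; split.
  by apply: ge_ereal_sup => _ [z xz <-]; rewrite lee_fin ymax.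
by apply: ereal_sup_ubound; exists y.
Qed.

(** Without a duality gap a primal maximizer y attains the dual bound:
    L x y l >= f x y = phi x = maxL x l. *)
Lemma argmax_feasible_argmax_Lagrangian x y l : vle 0 l ->
  argmax (feasible x) (f x) y -> maxL x l = phi x ->
  argmax Y (fun z => L x z l) y.
Proof.
move=> l0 xy eqv; have [fy _] := xy; have [Yy _] := fy; split=> // z Yz.
apply: le_trans (Lagrangian_ge l0 fy).
rewrite -lee_fin -(phi_argmax xy) -eqv.
by apply: ereal_sup_ubound; exists z.
Qed.

(** The feasible set is a closed part of the compact set Y, so the extreme value
    theorem applies. *)
Lemma exists_argmax_feasible x :
  continuous (fun p : 'cV[R]_n * 'cV[R]_m => f p.1 p.2) -> compact Y ->
  feasible x !=set0 -> exists y, argmax (feasible x) (f x) y.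
Proof.
move=> cf cY ne.
have cont i : continuous (fun y : 'cV[R]_m => (A *m x + B *m y) i 0).
  have rowE y : (A *m x + B *m y) i 0 =
      (A *m x) i 0 + \sum_(j < m) B i j * y j 0.
    by rewrite mxE [(B *m _) _ _]mxE.
  move=> z; rewrite /continuous_at rowE; under eq_fun do rewrite rowE.
  apply: (@cvgD _ _ _ (nbhs z) _); first exact: cvg_cst.
  apply: (@cvg_big _ _ +%R 0 xpredT _ _ (nbhs z)) => [|j _].
    exact: add_continuous.
  by apply: (@cvgM _ _ (nbhs z) _); [exact: cvg_cst|exact: coord_continuous].
have clx : closed [set y | vle (A *m x + B *m y) c].
  rewrite (_ : mkset _ = \bigcap_(i in setT)
      (fun y => (A *m x + B *m y) i 0) @^-1` [set r | r <= c i 0]).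
    apply: closed_bigI => i _.
    by apply: preimage_closed => [y _|]; [exact: cont|exact: closed_le].
  by apply/seteqP; split=> [y xy i _|y xy i]; [exact: xy|exact: (xy i)].
have [||y] := @compact_EVT_max _ R (f x) _ ne.
- exact: compact_closedI.
- apply: continuous_subspaceT => y.
  apply: (@continuous_comp _ _ _ (fun y => (x, y)) (fun p => f p.1 p.2)).
    exact: (@cvg_pair _ _ _ (nbhs y) (nbhs x) (nbhs y) _ _ _ _ _ (cvg_cst x)
      cvg_id).
  exact: cf.
rewrite inE => fy ymax; exists y; split=> // z fz; apply: (ymax z).
by rewrite inE.
Qed.

(** The function f x - f x y, where y is a constrained maximizer, is at most 0 on
    the feasible set; the multipliers that keep the Lagrangian of this function
    below 0 on Y bound L x . l by f x y = phi x. *)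
Lemma strong_duality x y : convex_set Y -> concave_function Y (f x) ->
  (exists y0, relint Y y0 /\ vle (residual x y0) 0) ->
  argmax (feasible x) (f x) y ->
  exists2 l, vle 0 l & maxL x l = phi x.
Proof.
move=> cY cf [y0 [ry0 hy0]] xy; have [_ ymax] := xy.
have cfy : concave_function Y (fun z => f x z - f x y).
  by apply: concave_functionB => // t u v; ring.
have [|z Yz hz|l l0 hl] := affine_multipliers cY cfy (residual_affine x)
  (relint_prolongable ry0).
- exact/vle0r.
- rewrite subr_le0; apply: ymax; split=> //; exact/vle_subr/vle0r.
have l0' : vle 0 (\col_i l i) by apply/vle0l => i; rewrite mxE.
exists (\col_i l i) => //; apply/eqP; rewrite eq_le weak_duality // andbT.
rewrite (phi_argmax xy); apply: ge_ereal_sup => _ [z Yz <-].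
rewrite lee_fin LagrangianE.
under eq_bigr do rewrite [(\col__ _) _ _]mxE.
by have := hl z Yz; lra.
Qed.

(** * Comparison of the problems and of their solutions *)

Lemma ereal_inf_pair (S T : Type) (C : set S) (D : set T)
    (F : S -> T -> \bar R) :
  ereal_inf [set ereal_inf [set F a b | b in D] | a in C] =
  ereal_inf [set F p.1 p.2 | p in C `*` D].
Proof.
apply/eqP; rewrite eq_le; apply/andP; split.
  apply: le_ereal_inf_tmp => _ [[a b] [/= Ca Db] <-].
  apply: ge_ereal_inf; exists (ereal_inf [set F a b | b in D]);
    first by exists a.
  by apply: ereal_inf_lbound; exists b.
apply: le_ereal_inf_tmp => _ [a Ca <-]; apply: le_ereal_inf_tmp => _ [b Db <-].
by apply: ereal_inf_lbound; exists (a, b).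
Qed.

(** Minimizing over x and then over l is minimizing over the pair: at a
    solution of either problem G l = maxL x l. *)
Lemma solution_D2_D3 x y l : vle 0 l -> D2 x y l <-> D3 x y l.
Proof.
have GleL l' x' : X x' -> (G l' <= maxL x' l')%E.
  by move=> Xx'; apply: ereal_inf_lbound; exists x'.
move=> l0; split=> [[[Xx xmin] ymax [_ lmin]]|[[[Xx _] xlmin] ymax]].
  split=> //; split=> // -[x' l'] [/= Xx' l0'].
  apply: le_trans (GleL _ _ Xx'); apply: le_trans (lmin _ l0').
  by apply: le_ereal_inf_tmp => _ [z Xz <-]; exact: xmin.
split=> //; first by split=> // x' Xx'; exact: (xlmin (x', l)).
split=> // l' l0'; apply: le_trans (GleL l x Xx) _.
by apply: le_ereal_inf_tmp => _ [z Xz <-]; exact: (xlmin (z, l')).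
Qed.

(** In the converse direction the maximizer y of the Lagrangian is not assumed
    feasible; it is identified with a primal maximizer by uniqueness. *)
Lemma solution_mMI_D3 mu x y : 0 < mu -> convex_set Y ->
  (forall z, X z -> strongly_concave mu Y (f z)) ->
  (forall z, X z -> exists w, argmax (feasible z) (f z) w) ->
  (forall z, X z -> exists2 l, vle 0 l & maxL z l = phi z) ->
  mMI x y <-> exists l, vle 0 l /\ D3 x y l.
Proof.
move=> mu0 cY scf attained dual; split.
  move=> [[Xx xmin] xy]; have [l l0 eqv] := dual x Xx.
  exists l; split=> //; split; last exact: argmax_feasible_argmax_Lagrangian.
  split=> // -[x' l'] [/= Xx' l0']; rewrite eqv.
  exact: le_trans (xmin _ Xx') (weak_duality _ l0').
move=> [l [l0 [[[/= Xx _] xlmin] ymax]]].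
have phi_eq : maxL x l = phi x.
  apply/eqP; rewrite eq_le weak_duality // andbT.
  by have [l' l0' <-] := dual x Xx; exact: (xlmin (x, l')).
split.
  split=> // x' Xx'; have [l' l0' <-] := dual x' Xx'.
  by rewrite -phi_eq; exact: (xlmin (x', l')).
have [w xw] := attained x Xx.
have wmax := argmax_feasible_argmax_Lagrangian l0 xw phi_eq.
have LE : (fun z => L x z l) =
    fun z => f x z - \sum_(i < k) l i 0 * residual x z i 0.
  by apply/funext => z; exact: LagrangianE.
rewrite LE in ymax wmax.
have ah := affine_functional_sum (fun i => l i 0) (residual_affine x).
by rewrite (strongly_concave_argmax_unique mu0 cY (scf x Xx) ah ymax wmax).
Qed.

End duality.

Theorem theorem3p4 (R : realType) (n m k : nat)
  (f : 'cV[R]_n -> 'cV[R]_m -> R)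
  (A : 'M[R]_(k, n)) (B : 'M[R]_(k, m)) (c : 'cV[R]_k)
  (X : set 'cV[R]_n) (Y : set 'cV[R]_m) (D mu_y : R)
  (f_continuous : continuous (fun p : 'cV[R]_n * 'cV[R]_m => f p.1 p.2))
  (X_convex : convex_set X) (X_compact : compact X)
  (Y_convex : convex_set Y) (Y_compact : compact Y)
  (D_gt0 : 0 < D)
  (X_bounded : forall x, X x -> enorm x <= D)
  (Y_bounded : forall y, Y y -> enorm y <= D)
  (feasibility : forall x, X x ->
    exists y, Y y /\ vle (A *m x + B *m y - c) 0)
  (mu_y_gt0 : 0 < mu_y)
  (f_strongly_concave : forall x, X x -> strongly_concave mu_y Y (f x))
  (slater : forall x, X x ->
    exists y, relint Y y /\ vle (A *m x + B *m y - c) 0) :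
  [/\ v_mMI f A B c X Y = v_D1 f A B c X Y,
      v_D1 f A B c X Y = v_D2 f A B c X Y
    & v_D2 f A B c X Y = v_D3 f A B c X Y] /\
  (forall (x : 'cV[R]_n) (y : 'cV[R]_m),
     solution_mMI f A B c X Y x y <->
     exists l : 'cV[R]_k, vle 0 l /\ solution_D2 f A B c X Y x y l) /\
  (forall (x : 'cV[R]_n) (y : 'cV[R]_m),
     solution_mMI f A B c X Y x y <->
     exists l : 'cV[R]_k, vle 0 l /\ solution_D3 f A B c X Y x y l).
Proof.
have feasible_ne x : X x -> feasible A B c Y x !=set0.
  by move=> /feasibility[y [Yy /vle_subr xy]]; exists y.
have attained x : X x -> exists y, argmax (feasible A B c Y x) (f x) y.
  by move=> /feasible_ne; exact: exists_argmax_feasible.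
have dual x : X x -> exists2 l, vle 0 l & maxL f A B c Y x l = phi f A B c Y x.
  move=> Xx; have [y xy] := attained x Xx.
  apply: strong_duality xy => //; last exact: slater.
  exact: strongly_concave_concave (ltW mu_y_gt0) (f_strongly_concave x Xx).
have D23 : v_D2 f A B c X Y = v_D3 f A B c X Y.
  rewrite /v_D2 /G ereal_inf_pair /v_D3; congr ereal_inf.
  apply/seteqP; split=> _ [[u v] [/= Cu Dv] <-];
    by exists (v, u).
have D13 : v_D1 f A B c X Y = v_D3 f A B c X Y by exact: ereal_inf_pair.
have solD3 x y := solution_mMI_D3 x y mu_y_gt0 Y_convex f_strongly_concave
  attained dual.
split; [split=> //; last by rewrite D13 D23|split=> // x y].
  congr ereal_inf; apply: eq_imagel => x Xx; have [l l0 eql] := dual x Xx.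
  apply/eqP; rewrite eq_le; apply/andP; split.
    by apply: le_ereal_inf_tmp => _ [l' l0' <-]; exact: weak_duality.
  by rewrite -eql; apply: ereal_inf_lbound; exists l.
rewrite solD3; split=> -[l [l0 sol]]; exists l; split=> //.
  by apply/(solution_D2_D3 f A B c X Y x y l0).
by apply/(solution_D2_D3 f A B c X Y x y l0).
Qed.
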